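(* Let $k$ be a field and $n\ge 3$. The Poincaré series of the wheel graph algebra $W_n$ is $$P_{W_n}(t)=\frac{P_{C_n}(t)(1+t)}{1+t-tP_{C_n}(t)}.$$
   Context: For a graded $k$-algebra $R=k[x_1,\ldots,x_N]/I$ ($I$ a homogeneous ideal, standard grading), the Poincaré series is the formal power series $P_R(t)=\sum_{i\ge 0}\dim_k \mathrm{Tor}_i^R(k,k)\,t^i$. The same symbol is used for a graph and its graph algebra. Cycle graph algebra: $C_n=k[x_1,\ldots,x_n]/(x_1x_2,x_2x_3,\ldots,x_{n-1}x_n,x_nx_1)$. The wheel graph $W_n$ is the cycle $C_n$ with an extra vertex $x_0$ (the center) connected to all vertices of $C_n$; its algebra is $W_n=k[x_0,\ldots,x_n]/(x_1x_2,x_2x_3,\ldots,x_nx_1,x_0x_1,\ldots,x_0x_n)$. *)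

(* Defs.v *)
From HB Require Import structures.
From mathcomp Require Import all_boot all_algebra.
From mathcomp Require Import generic_quotient ring_quotient mpoly.
From mathcomp Require Import boolp classical_sets.

Set Implicit Arguments.
Unset Strict Implicit.
Unset Printing Implicit Defensive.

Import GRing.Theory.
Local Open Scope ring_scope.

Definition fps (R : Type) := nat -> R.

Section FpsRing.
Variable R : comUnitRingType.
Implicit Types a b c : fps R.

HB.instance Definition _ := gen_eqMixin (fps R).
HB.instance Definition _ := gen_choiceMixin (fps R).

Definition fps_zero : fps R := fun _ => 0.
Definition fps_opp a : fps R := fun i => - a i.
Definition fps_add a b : fps R := fun i => a i + b i.
Definition fps_one : fps R := fun i => (i == 0%N)%:R.
Definition fps_mul a b : fps R := fun i => \sum_(j < i.+1) a j * b (i - j)%N.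

Lemma fps_addA : associative fps_add.
Proof. by move=> a b c; apply: funext => i; apply: addrA. Qed.

Lemma fps_addC : commutative fps_add.
Proof. by move=> a b; apply: funext => i; apply: addrC. Qed.

Lemma fps_add0 : left_id fps_zero fps_add.
Proof. by move=> a; apply: funext => i; apply: add0r. Qed.

Lemma fps_addN : left_inverse fps_zero fps_opp fps_add.
Proof. by move=> a; apply: funext => i; apply: addNr. Qed.

HB.instance Definition _ :=
  GRing.isZmodule.Build (fps R) fps_addA fps_addC fps_add0 fps_addN.

Definition fps_trunc (m : nat) a : {poly R} := \poly_(i < m) a i.

Lemma fps_mul_trunc m a b i : (i < m)%N ->
  fps_mul a b i = (fps_trunc m a * fps_trunc m b)`_i.
Proof.
move=> im; rewrite coefM; apply: eq_bigr => j _.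
have jm : (j < m)%N by apply: leq_trans im; apply: ltn_ord.
have ijm : (i - j < m)%N by apply: leq_ltn_trans im; apply: leq_subr.
by rewrite !coef_poly jm ijm.
Qed.

Lemma fps_mulC : commutative fps_mul.
Proof.
move=> a b; apply: funext => i.
by rewrite !(@fps_mul_trunc i.+1) // mulrC.
Qed.

Lemma fps_mulA : associative fps_mul.
Proof.
move=> a b c; apply: funext => i.
transitivity ((fps_trunc i.+1 a * (fps_trunc i.+1 b * fps_trunc i.+1 c))`_i).
  rewrite coefM; apply: eq_bigr => j _.
  rewrite coef_poly ltn_ord (@fps_mul_trunc i.+1) //.
  by rewrite ltnS leq_subr.
rewrite mulrA coefM; apply: eq_bigr => j _.
rewrite [X in _ * X]coef_poly ltnS leq_subr.
by rewrite -fps_mul_trunc.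
Qed.

Lemma fps_mul1 : left_id fps_one fps_mul.
Proof.
move=> a; apply: funext => i; rewrite /fps_mul big_ord_recl /=.
rewrite /fps_one eqxx mul1r subn0 big1 ?addr0 // => j _.
by rewrite /= mul0r.
Qed.

Lemma fps_mulDl : left_distributive fps_mul fps_add.
Proof.
move=> a b c; apply: funext => i; rewrite /fps_mul /fps_add -big_split.
by apply: eq_bigr => j _; apply: mulrDl.
Qed.

Lemma fps_oner_neq0 : fps_one != 0.
Proof.
apply/eqP => /(congr1 (fun a : fps R => a 0%N)) /eqP.
by rewrite /fps_one eqxx oner_eq0.
Qed.

HB.instance Definition _ := GRing.Zmodule_isComNzRing.Build (fps R)
  fps_mulA fps_mulC fps_mul1 fps_mulDl fps_oner_neq0.

(* The first [n.+1] coefficients of the inverse of [a], obtained by solving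
   [\sum_(j <= i) b j * a (i - j) = (i == 0)] for [b i]. *)
Fixpoint fps_inv_seq a (n : nat) : seq R :=
  if n is m.+1 then
    let s := fps_inv_seq a m in
    rcons s (- (a 0%N)^-1 * \sum_(j < m.+1) s`_j * a (m.+1 - j)%N)
  else [:: (a 0%N)^-1].

Definition fps_unit : pred (fps R) := fun a => a 0%N \is a GRing.unit.

Definition fps_inv a : fps R :=
  if fps_unit a then fun i => (fps_inv_seq a i)`_i else a.

Lemma size_fps_inv_seq a n : size (fps_inv_seq a n) = n.+1.
Proof. by elim: n => //= n IHn; rewrite size_rcons IHn. Qed.

Lemma nth_fps_inv_seq a n i : (i <= n)%N ->
  (fps_inv_seq a n)`_i = (fps_inv_seq a i)`_i.
Proof.
elim: n => [|n IHn]; first by rewrite leqn0 => /eqP->.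
rewrite leq_eqVlt => /orP[/eqP->//|]; rewrite ltnS => le_in /=.
by rewrite nth_rcons size_fps_inv_seq ltnS le_in IHn.
Qed.

Lemma fps_mulVr : {in fps_unit, left_inverse 1 fps_inv *%R}.
Proof.
move=> a ua; apply: funext => i; rewrite /fps_inv.
have -> : fps_unit a by [].
have ua0 : a 0%N \is a GRing.unit := ua.
case: i => [|i].
  by rewrite /GRing.mul /= /fps_mul big_ord_recl big_ord0 addr0 /= mulVr.
rewrite /GRing.mul /= /fps_mul big_ord_recr /= subnn.
rewrite nth_rcons size_fps_inv_seq ltnn eqxx mulrC mulrA mulrN mulrV //.
rewrite mulN1r; apply/eqP; rewrite subr_eq0; apply/eqP.
apply: eq_bigr => j _.
by rewrite (@nth_fps_inv_seq a i) // -ltnS ltn_ord.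
Qed.

Lemma fps_unitPl a b : b * a = 1 -> fps_unit a.
Proof.
move=> /(congr1 (fun c : fps R => c 0%N)).
rewrite /GRing.mul /= /fps_mul big_ord_recl big_ord0 addr0 /= => ba1.
by apply/unitrPr; exists (b 0%N); rewrite mulrC.
Qed.

Lemma fps_inv_out : {in [predC fps_unit], fps_inv =1 id}.
Proof. by move=> a /negbTE nua; rewrite /fps_inv; move: nua; rewrite /in_mem /= => ->. Qed.

HB.instance Definition _ := GRing.ComNzRing_hasMulInverse.Build (fps R)
  fps_mulVr fps_unitPl fps_inv_out.

Definition fps_t : fps R := fun i => (i == 1%N)%:R.

End FpsRing.

Section Tor.
Variables (k : fieldType) (R : comNzRingType) (eps : {rmorphism R -> k}).

(* Resolutions of [k], seen as an [R]-module through [eps], by free modules of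
   finite rank; these exist over any Noetherian [R] when [eps] is onto.
   Modules are spaces of row vectors and maps act by right multiplication, so
   the resolution reads
     ... -> 'rV[R]_(rk 2) -> 'rV[R]_(rk 1) -> 'rV[R]_(rk 0) -> k -> 0;
   an [R]-linear map from 'rV[R]_(rk 0) to [k] is given by its values
   [res_aug] on the standard basis. *)
Record free_resolution := FreeResolution {
  rk : nat -> nat;
  res_d : forall i, 'M[R]_(rk i.+1, rk i);
  res_aug : 'cV[k]_(rk 0);
  res_aug_onto : forall c : 'M[k]_1,
    exists u : 'rV[R]_(rk 0), map_mx eps u *m res_aug = c;
  res_exact0 : forall u : 'rV[R]_(rk 0),
    map_mx eps u *m res_aug = 0 <-> exists v, u = v *m res_d 0;
  res_exactS : forall i (u : 'rV[R]_(rk i.+1)),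
    u *m res_d i = 0 <-> exists v, u = v *m res_d i.+1
}.

(* The differentials of [F (x)_R k], whose terms are the ['rV[k]_(rk F i)]. *)
Definition tensor_d (F : free_resolution) (i : nat) :
  'M[k]_(rk F i.+1, rk F i) := map_mx eps (res_d F i).

Definition homology_dim (F : free_resolution) (i : nat) : nat :=
  match i with
  | 0 => rk F 0 - \rank (tensor_d F 0)
  | j.+1 => \rank (kermx (tensor_d F j)) - \rank (tensor_d F j.+1)
  end.

(* [dim_k Tor_i^R(k, k)]; the set is a singleton when resolutions exist, since
   Tor does not depend on the resolution. *)
Definition tor_dim (i : nat) : nat :=
  xget 0%N [set d | exists F : free_resolution, d = homology_dim F i].

Definition poincare_series : fps int := fun i => (tor_dim i)%:Z.

End Tor.

Section GraphAlgebra.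
Variables (k : fieldType) (N : nat) (e : rel 'I_N).

Definition edge_ideal : {pred {mpoly k[N]}} :=
  fun p => `[< exists q : 'I_N -> 'I_N -> {mpoly k[N]},
    p = \sum_(i < N) \sum_(j < N | e i j) q i j * ('X_i * 'X_j) >].

Lemma edge_ideal_meval0 p : p \in edge_ideal -> p.@[fun=> 0] = 0.
Proof.
rewrite unfold_in => /asboolP[q ->]; rewrite rmorph_sum big1 // => i _.
rewrite rmorph_sum big1 // => j _.
by rewrite !rmorphM /= mevalXU mul0r mulr0.
Qed.

Lemma edge_ideal_closed : idealr_closed edge_ideal.
Proof.
split.
- rewrite unfold_in; apply/asboolP; exists (fun _ _ => 0).
  by rewrite big1 // => i _; rewrite big1 // => j _; rewrite mul0r.
- apply/negP => /edge_ideal_meval0 /eqP.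
  by rewrite rmorph1 oner_eq0.
- move=> a u v; rewrite !unfold_in => /asboolP[q ->] /asboolP[r ->].
  apply/asboolP; exists (fun i j => a * q i j + r i j).
  rewrite mulr_sumr -big_split; apply: eq_bigr => i _.
  rewrite mulr_sumr -big_split; apply: eq_bigr => j _.
  by rewrite [RHS]mulrDl -[a * q i j * _]mulrA.
Qed.

HB.instance Definition _ :=
  isIdealr.Build {mpoly k[N]} edge_ideal edge_ideal_closed.

Definition graph_algebra : comNzRingType := {ideal_quot edge_ideal}.

(* The residue map [x_i |-> 0] onto [k]. *)
Definition graph_aug (x : graph_algebra) : k :=
  (repr x : {mpoly k[N]}).@[fun=> 0].

Lemma graph_aug_pi (p : {mpoly k[N]}) :
  graph_aug (\pi_({ideal_quot edge_ideal})%qT p) = p.@[fun=> 0].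
Proof.
apply/eqP; rewrite -subr_eq0 -rmorphB; apply/eqP.
apply: edge_ideal_meval0.
by rewrite Quotient.idealrBE reprK.
Qed.

Lemma graph_aug_is_zmod_morphism : zmod_morphism graph_aug.
Proof.
move=> x y; rewrite -[x]reprK -[y]reprK -rmorphB.
by rewrite !graph_aug_pi rmorphB.
Qed.

Lemma graph_aug_is_monoid_morphism : monoid_morphism graph_aug.
Proof.
split; first by rewrite -(rmorph1 (\pi_({ideal_quot edge_ideal})%qT)) graph_aug_pi rmorph1.
move=> x y; rewrite -[x]reprK -[y]reprK -rmorphM.
by rewrite !graph_aug_pi rmorphM.
Qed.

HB.instance Definition _ :=
  GRing.isZmodMorphism.Build graph_algebra k graph_aug
    graph_aug_is_zmod_morphism.
HB.instance Definition _ :=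
  GRing.isMonoidMorphism.Build graph_algebra k graph_aug
    graph_aug_is_monoid_morphism.

Definition graph_poincare : fps int := poincare_series graph_aug.

End GraphAlgebra.

(* For [n >= 3], the cycle on [x_1, ..., x_n], with [x_(i+1)] at index [i];
   [ordS] is the cyclic successor. *)
Definition cycle_graph (n : nat) : rel 'I_n :=
  fun i j => (j == ordS i) || (i == ordS j).

(* The center [x_0] is [ord0], and the vertex [i] of the cycle becomes
   [lift ord0 i]. *)
Definition wheel_graph (n : nat) : rel 'I_n.+1 :=
  fun i j =>
    match unlift ord0 i, unlift ord0 j with
    | Some i', Some j' => cycle_graph i' j'
    | None, None => false
    | _, _ => true
    end.

(* Main.v *)
Require Import Defs.
From mathcomp Require Import all_boot all_algebra.
From mathcomp Require Import generic_quotient ring_quotient mpoly.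
From mathcomp Require Import boolp classical_sets.
From mathcomp Require Import zify ring.

Set Implicit Arguments.
Unset Strict Implicit.
Unset Printing Implicit Defensive.

Import GRing.Theory.
Local Open Scope ring_scope.

(** The residue field of a graph algebra [R] has a linear free resolution whose
    ranks can be read off the graph. For a set [S] of vertices let [(S)] be the
    ideal of [R] generated by the variables [x_s], [s] in [S]. If [t] is not in
    [S], then the colon ideal [(S) : x_t] is [(S + N(t))], where [N(t)] is the
    set of neighbours of [t]: again an ideal generated by variables
    ([in_vars_colon]). So, adding the variables of [S] one at a time in
    increasing order, the syzygies of each variable modulo the smaller ones form
    the ideal of [colon_vars S t] = [{s in S | s < t} + N(t)], and the
    construction repeats. The basis in degree [i] consists of the words
    [t_1 ... t_i] with [t_1] in [S], [t_2] in [colon_vars S t_1], and so on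
    ([linear_resolution]). The differentials have entries in the maximal ideal,
    so the ranks are the dimensions of Tor ([tor_dim_betti]); with
    [B S] the generating series of the numbers of words,
    [B S = 1 + t * \sum_(s in S) B (colon_vars S s)], and the Poincare series
    is [B] of the set of all vertices.

    The value of [tor_dim] may be computed from any resolution, because two
    resolutions of [k] are linked by comparison maps that are inverse to each
    other up to homotopy ([homology_dim_le]).

    The wheel is the cone over the cycle, and the formula holds for the cone over
    any graph. Let [S'] be the set of rim vertices over [S], and [S^] this set
    with the center [0] added, which comes first in the order. As [0] is a
    neighbour of every rim vertex, [colon_vars S^ j] and [colon_vars S' j] are
    both [(colon_vars S j)^], while [colon_vars S^ 0] is the whole rim. With [V]
    the series of the whole rim in the cone, this gives [B S^ = B S' + t V], and
    both [B S^] and [(1 + t V) * B S] satisfy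
    [D S = 1 + t V + t * \sum_(s in S) D (colon_vars S s)], a recursion with
    only one solution. For the set of all vertices,
    [PW = (1 + t) V = (1 + t V) PC]; eliminating [V] gives the formula. *)

(** * Betti numbers do not depend on the resolution *)

(** If [f] and [g] carry cycles to cycles and boundaries to boundaries, and
    [f *m g] is the identity on homology, then [f] is injective on homology:
    an element of [Z] that [f] sends into [B'] comes back by [g] into [B]. *)
Lemma rank_subquotient_le (k : fieldType) (m n a b c d : nat)
    (Z : 'M[k]_(a, m)) (B : 'M_(b, m)) (Z' : 'M_(c, n)) (B' : 'M_(d, n))
    (f : 'M_(m, n)) (g : 'M_(n, m)) :
  (Z *m f <= Z')%MS -> (B' <= Z')%MS -> (B' *m g <= B)%MS ->
  (Z - Z *m f *m g <= B)%MS ->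
  (\rank Z - \rank B <= \rank Z' - \rank B')%N.
Proof.
move=> ZfZ' B'Z' B'gB ZfgB; pose q := cokermx B'.
have B'q : (B' <= Z' :&: kermx q)%MS.
  by rewrite sub_capmx B'Z' /=; apply/sub_kermxP; rewrite mulmx_coker.
have capB : (Z :&: kermx (f *m q) <= B)%MS.
  set X := (Z :&: kermx (f *m q))%MS.
  have /submxP [Y XYZ] : (X <= Z)%MS by apply: capmxSl.
  have XfB' : (X *m f <= B')%MS.
    rewrite submxE -mulmxA; apply/eqP/sub_kermxP; exact: capmxSr.
  have -> : X = Y *m (Z - Z *m f *m g) + X *m f *m g.
    by rewrite mulmxBr !mulmxA -XYZ subrK.
  rewrite addmx_sub ?(submx_trans (submxMr g XfB')) //.
  exact: submx_trans (submxMl _ _) ZfgB.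
have rZ := mxrank_mul_ker Z (f *m q).
have rZ' := mxrank_mul_ker Z' q.
have le1 : (\rank (Z *m (f *m q)) <= \rank (Z' *m q))%N.
  by rewrite mulmxA mxrankS // submxMr.
have := mxrankS capB; have := mxrankS B'q; lia.
Qed.

Section TorIndependence.
Variables (k : fieldType) (R : comNzRingType) (eps : {rmorphism R -> k}).
Implicit Types F G : free_resolution eps.

Lemma lift_rows m n p (D : 'M[R]_(n, p)) (A : 'M[R]_(m, p)) :
  (forall j, exists v, row j A = v *m D) -> exists B, A = B *m D.
Proof.
move=> /choice[f fP]; exists (\matrix_j f j).
by apply/row_matrixP => j; rewrite fP row_mul rowK.
Qed.

Lemma lift_aug F m (C : 'M[k]_(m, 1)) :
  exists A : 'M[R]_(m, rk F 0), map_mx eps A *m res_aug F = C.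
Proof.
have /choice[f fP] j := res_aug_onto F (row j C).
exists (\matrix_j f j).
by apply/row_matrixP => j; rewrite row_mul -map_row rowK fP.
Qed.

Lemma lift0 F m (A : 'M[R]_(m, rk F 0)) :
  map_mx eps A *m res_aug F = 0 -> exists B, A = B *m res_d F 0.
Proof.
move=> A0; apply: lift_rows => j; apply/res_exact0.
by rewrite map_row -row_mul A0 row0.
Qed.

Lemma liftS F i m (A : 'M[R]_(m, rk F i.+1)) :
  A *m res_d F i = 0 -> exists B, A = B *m res_d F i.+1.
Proof.
move=> A0; apply: lift_rows => j; apply/res_exactS.
by rewrite -row_mul A0 row0.
Qed.

Lemma res_d0_aug F : map_mx eps (res_d F 0) *m res_aug F = 0.
Proof.
apply/row_matrixP => j; rewrite row_mul -map_row row0.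
by apply/res_exact0; exists (delta_mx 0 j); rewrite rowE.
Qed.

Lemma res_dd F i : res_d F i.+1 *m res_d F i = 0.
Proof.
apply/row_matrixP => j; rewrite row_mul row0.
by apply/res_exactS; exists (delta_mx 0 j); rewrite rowE.
Qed.

Definition chain_map F G (f : forall i, 'M[R]_(rk F i, rk G i)) :=
  map_mx eps (f 0%N) *m res_aug G = res_aug F /\
  forall i, f i.+1 *m res_d G i = res_d F i *m f i.

(** A lift is chosen in each degree; [comparisonP] shows that the default value
    [0] is never taken. *)
Fixpoint comparison F G i : 'M[R]_(rk F i, rk G i) :=
  match i with
  | 0 => xget 0 [set f | map_mx eps f *m res_aug G = res_aug F]
  | j.+1 => xget 0 [set f | f *m res_d G j = res_d F j *m comparison F G j]
  end.

(** The map to be lifted has values in the cycles of [G], which are boundaries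
    by exactness. *)
Lemma comparisonP F G : chain_map (comparison F G).
Proof.
have c0 : map_mx eps (comparison F G 0) *m res_aug G = res_aug F.
  exact: (xgetPex 0 (lift_aug G (res_aug F))).
split=> //; elim=> [|i IHi].
  apply: (@xgetPex _ _ [set f | f *m res_d G 0 = _]).
  have [|B] := @lift0 G _ (res_d F 0 *m comparison F G 0); last by exists B.
  by rewrite map_mxM -mulmxA c0 res_d0_aug.
apply: (@xgetPex _ _ [set f | f *m res_d G i.+1 = _]).
have [|B] := @liftS G i _ (res_d F i.+1 *m comparison F G i.+1).
  by rewrite -mulmxA IHi mulmxA res_dd mul0mx.
by exists B.
Qed.

Fixpoint homotopy F (f : forall i, 'M[R]_(rk F i, rk F i)) i :
    'M[R]_(rk F i, rk F i.+1) :=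
  match i with
  | 0 => xget 0 [set h | h *m res_d F 0 = f 0%N - 1%:M]
  | j.+1 => xget 0 [set h | h *m res_d F j.+1 =
                            f j.+1 - 1%:M - res_d F j *m homotopy f j]
  end.

(** An endomorphism of [F] over the identity of [k] is homotopic to the identity:
    what remains of [f - 1] after the homotopy in the previous degree is a cycle,
    hence lifts. *)
Lemma homotopyP F (f : forall i, 'M[R]_(rk F i, rk F i)) : chain_map f ->
  homotopy f 0 *m res_d F 0 = f 0%N - 1%:M /\
  forall i, homotopy f i.+1 *m res_d F i.+1 =
            f i.+1 - 1%:M - res_d F i *m homotopy f i.
Proof.
move=> [f0 fS].
have h0 : homotopy f 0 *m res_d F 0 = f 0%N - 1%:M.
  apply: (@xgetPex _ _ [set h | h *m res_d F 0 = _]).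
  have [|B] := @lift0 F _ (f 0%N - 1%:M); last by exists B.
  by rewrite map_mxB map_mx1 mulmxBl f0 mul1mx subrr.
have hS i :
    (f i.+1 - 1%:M - res_d F i *m homotopy f i) *m res_d F i = 0 ->
    homotopy f i.+1 *m res_d F i.+1 =
      f i.+1 - 1%:M - res_d F i *m homotopy f i.
  move=> /liftS[B eB].
  by apply: (@xgetPex _ _ [set h | h *m res_d F i.+1 = _]); exists B.
split=> //; elim=> [|i IHi]; apply: hS; rewrite !mulmxBl fS mul1mx -mulmxA.
  by rewrite h0 mulmxBr mulmx1 subrr.
rewrite IHi !mulmxBr mulmx1 [_ *m (_ *m homotopy f i)]mulmxA res_dd mul0mx.
by rewrite subr0 subrr.
Qed.

Definition tensor_cycles F i : 'M[k]_(rk F i) :=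
  match i with
  | 0 => 1%:M
  | j.+1 => kermx (tensor_d F j)
  end.

Lemma homology_dimE F i :
  homology_dim F i = (\rank (tensor_cycles F i) - \rank (tensor_d F i))%N.
Proof. by case: i => //=; rewrite mxrank1. Qed.

Lemma tensor_boundary_sub F i : (tensor_d F i <= tensor_cycles F i)%MS.
Proof.
case: i => [|i]; first exact: submx1.
by apply/sub_kermxP; rewrite -map_mxM res_dd map_mx0.
Qed.

Lemma chain_map_cycles F G (f : forall i, 'M[R]_(rk F i, rk G i)) i :
  chain_map f ->
  (tensor_cycles F i *m map_mx eps (f i) <= tensor_cycles G i)%MS.
Proof.
move=> [_ fS]; case: i => [|i]; first exact: submx1.
apply/sub_kermxP; rewrite -mulmxA -map_mxM fS map_mxM mulmxA.
by rewrite mulmx_ker mul0mx.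
Qed.

Lemma chain_map_comp F G H (f : forall i, 'M[R]_(rk F i, rk G i))
    (g : forall i, 'M[R]_(rk G i, rk H i)) :
  chain_map f -> chain_map g -> chain_map (fun i => f i *m g i).
Proof.
move=> [f0 fS] [g0 gS]; split=> [|i]; first by rewrite map_mxM -mulmxA g0.
by rewrite -mulmxA gS !mulmxA fS.
Qed.

(** Going from [F] to [G] and back is homotopic to the identity, so on the cycles
    of [F (x)_R k] it differs from the identity by boundaries. *)
Lemma homology_dim_le F G i : (homology_dim F i <= homology_dim G i)%N.
Proof.
rewrite !homology_dimE.
pose f := comparison F G; pose g := comparison G F.
have fP : chain_map f := comparisonP F G.
have gP : chain_map g := comparisonP G F.
have [h0 hS] := homotopyP (chain_map_comp fP gP).
apply: (rank_subquotient_le (f := map_mx eps (f i)) (g := map_mx eps (g i))).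
- exact: chain_map_cycles.
- exact: tensor_boundary_sub.
- by rewrite -map_mxM -gP.2 map_mxM submxMl.
(* On a cycle only the summand [h *m d] of the homotopy formula survives, and its
   values are boundaries. *)
rewrite -mulmxA -map_mxM -[X in X - _]mulmx1 -mulmxBr.
rewrite -(map_mx1 eps) -map_mxB -opprB map_mxN mulmxN eqmx_opp.
case: i => [|i]; first by rewrite -h0 map_mxM mulmxA submxMl.
have /esym/(canRL (subrK _)) -> := hS i.
rewrite map_mxD !map_mxM mulmxDr [X in _ + X]mulmxA mulmx_ker mul0mx addr0.
by rewrite mulmxA submxMl.
Qed.

Lemma tor_dimE F i : tor_dim eps i = homology_dim F i.
Proof.
rewrite /tor_dim; apply: xget_unique; first by exists F.
by move=> _ [G ->]; apply/eqP; rewrite eqn_leq !homology_dim_le.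
Qed.

End TorIndependence.

(** * Monomial ideals of a graph algebra *)

Section GraphAlgebraIdeals.
Variables (k : fieldType) (N : nat) (e : rel 'I_N).
Hypothesis e_sym : ssrbool.symmetric e.
Local Notation poly := {mpoly k[N]}.
Local Notation R := (graph_algebra k e).
Local Notation eps := (@graph_aug k N e).
Local Notation toR := (\pi_({ideal_quot (edge_ideal e)})%qT : poly -> R).
Implicit Types (P : pred 'X_{1..N}) (m : 'X_{1..N}) (p q : poly) (u v : R).
Implicit Types (S : {set 'I_N}) (i j t : 'I_N).

Definition upward P := forall m m', P m -> P (m + m')%MM.

Definition supported_in P p := forall m, m \in msupp p -> P m.

Lemma supported_in0 P : supported_in P 0.
Proof. by move=> m; rewrite msupp0. Qed.

Lemma supported_inD P p q :
  supported_in P p -> supported_in P q -> supported_in P (p + q).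
Proof.
by move=> Pp Pq m /msuppD_le; rewrite mem_cat => /orP[/Pp|/Pq].
Qed.

Lemma supported_inN P p : supported_in P p -> supported_in P (- p).
Proof. by move=> Pp m; rewrite (perm_mem (msuppN p)) => /Pp. Qed.

Lemma supported_in_sum P (I : Type) (r : seq I) (Q : pred I) (F : I -> poly) :
  (forall x, Q x -> supported_in P (F x)) ->
  supported_in P (\sum_(x <- r | Q x) F x).
Proof.
move=> PF; apply: big_ind => //; first exact: supported_in0.
exact: supported_inD.
Qed.

Lemma supported_inM P p q :
  upward P -> supported_in P p -> supported_in P (p * q).
Proof.
by move=> upP Pp m /msuppM_le /allpairsP[[m1 m2] /= [/Pp Pm1 _ ->]]; apply: upP.
Qed.

Lemma supported_inX P m : P m -> supported_in P 'X_[m].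
Proof. by move=> Pm m' /mem_msuppXP <-. Qed.

Definition edge_monomial : pred 'X_{1..N} := fun m =>
  [exists i, exists j, e i j && (U_(i) + U_(j) <= m)%MM].

Lemma edge_monomialP m :
  reflect (exists i j, e i j /\ exists m', m = (U_(i) + U_(j) + m')%MM)
          (edge_monomial m).
Proof.
apply: (iffP existsP) => [[i /existsP[j /andP[eij le_m]]]|[i [j [eij [m' ->]]]]].
  exists i, j; split=> //; exists (m - (U_(i) + U_(j)))%MM.
  by rewrite addmC submK.
by exists i; apply/existsP; exists j; rewrite eij lem_addr.
Qed.

Lemma edge_monomial_up : upward edge_monomial.
Proof.
move=> m m' /edge_monomialP[i [j [eij [m2 ->]]]]; apply/edge_monomialP.
by exists i, j; split=> //; exists (m2 + m')%MM; rewrite addmA.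
Qed.

(** Membership in a monomial ideal is decided monomial by monomial, which is what
    makes the ideals of [R] below computable. *)
Lemma edge_idealP p :
  p \in edge_ideal e <-> supported_in edge_monomial p.
Proof.
split=> [|Pp].
  rewrite unfold_in => /asboolP[q ->].
  apply: supported_in_sum => i _; apply: supported_in_sum => j eij.
  rewrite mulrC; apply: supported_inM; first exact: edge_monomial_up.
  rewrite -mpolyXD; apply: supported_inX; apply/edge_monomialP.
  by exists i, j; split=> //; exists 0%MM; rewrite addm0.
rewrite [p]mpolyE big_seq; apply: rpred_sum => m /Pp /edge_monomialP.
move=> [i [j [eij [m' ->]]]].
rewrite -mul_mpolyC addmC mpolyXD mpolyXD mulrA; apply: idealMr.
rewrite unfold_in; apply/asboolP.
exists (fun a b => ((a == i) && (b == j))%:R).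
rewrite (bigD1 i) //= (bigD1 j) //= !eqxx mul1r !big1 ?addr0 //.
  by move=> a /negPf ->; rewrite big1 // => b _; rewrite mul0r.
by move=> b /andP[_ /negPf->]; rewrite mul0r.
Qed.

(** Ideals of [R] generated by monomials; the choice of the representative is
    harmless when [P] contains the edge monomials. *)
Definition in_monomial_ideal P u := supported_in P (repr u).

Lemma in_monomial_ideal_pi P p :
  (forall m, edge_monomial m -> P m) ->
  in_monomial_ideal P (toR p) <-> supported_in P p.
Proof.
move=> eP; have : supported_in P (repr (toR p) - p).
  move=> m Hm; apply: eP; move: m Hm; apply/edge_idealP.
  by rewrite Quotient.idealrBE reprK.
move=> Pd; split=> Pp; last first.
  by rewrite /in_monomial_ideal -[repr (toR p)](subrK p); apply: supported_inD.
by rewrite -[p](subKr (repr (toR p))); apply/supported_inD/supported_inN.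
Qed.

Definition var t : R := toR 'X_t.

Lemma eps_var t : eps (var t) = 0.
Proof. by rewrite graph_aug_pi mevalXU. Qed.

Lemma var_edge i j : e i j -> var i * var j = 0.
Proof.
move=> eij; rewrite /var -rmorphM -[RHS](rmorph0 toR); apply/eqP.
rewrite -Quotient.idealrBE subr0; apply/edge_idealP; rewrite -mpolyXD.
by apply: supported_inX; apply/edge_monomialP; exists i, j; split=> //;
  exists 0%MM; rewrite addm0.
Qed.

Lemma meval0 p : p.@[fun=> 0] = p@_0%MM.
Proof.
rewrite {1}[p]mpolyE raddf_sum [in RHS](mpolyE p) raddf_sum /=.
apply: eq_bigr => m _; rewrite mevalZ mevalX mcoeffZ mcoeffX; congr (_ * _).
have [->|] := eqVneq m 0%MM; first by rewrite big1 // => i _; rewrite mnm0E.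
rewrite -mdeg_eq0 mdegE sum_nat_eq0 negb_forall => /existsP[i /= m_i].
by rewrite (bigD1 i) //= expr0n (negPf m_i) mul0r.
Qed.

Lemma eps0P u : eps u = 0 <-> supported_in (fun m => 0 < mdeg m)%N (repr u).
Proof.
rewrite /graph_aug meval0; split=> [u0 m|u0].
  rewrite lt0n mdeg_eq0 mcoeff_msupp; apply: contra => /eqP->.
  by rewrite u0.
by apply/eqP; rewrite mcoeff_eq0; apply/negP => /u0; rewrite mdeg0.
Qed.

(** The upward closed sets of monomials that contain the edges, that is, the
    monomial ideals of [R]. *)
Definition saturated P := upward P /\ forall m, edge_monomial m -> P m.

Lemma in_monomial_ideal0 P : saturated P -> in_monomial_ideal P 0.
Proof.
move=> [_ eP]; rewrite -(rmorph0 toR); apply/(in_monomial_ideal_pi _ eP).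
exact: supported_in0.
Qed.

Lemma in_monomial_idealD P u v : saturated P ->
  in_monomial_ideal P u -> in_monomial_ideal P v -> in_monomial_ideal P (u + v).
Proof.
move=> [_ eP] Pu Pv; rewrite -[u]reprK -[v]reprK -rmorphD.
by apply/(in_monomial_ideal_pi _ eP); apply: supported_inD.
Qed.

Lemma in_monomial_idealM P u v : saturated P ->
  in_monomial_ideal P u -> in_monomial_ideal P (v * u).
Proof.
move=> [upP eP] Pu; rewrite mulrC -[u]reprK -[v]reprK -rmorphM.
by apply/(in_monomial_ideal_pi _ eP); apply: supported_inM.
Qed.

Lemma in_monomial_ideal_sum P (I : Type) (r : seq I) (Q : pred I) (F : I -> R) :
  saturated P -> (forall x, Q x -> in_monomial_ideal P (F x)) ->
  in_monomial_ideal P (\sum_(x <- r | Q x) F x).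
Proof.
move=> sP PF; apply: big_ind => //; first exact: in_monomial_ideal0.
by move=> u v; apply: in_monomial_idealD.
Qed.

Definition var_monomial S : pred 'X_{1..N} := fun m =>
  edge_monomial m || [exists t in S, (0 < m t)%N].

Lemma var_monomial_saturated S : saturated (var_monomial S).
Proof.
split=> [m m' /orP[em|/exists_inP[t tS mt]]|m em]; rewrite /var_monomial.
- by rewrite edge_monomial_up.
- by apply/orP; right; apply/exists_inP; exists t; rewrite // mnmDE addn_gt0 mt.
- by rewrite em.
Qed.

Lemma degree2_saturated : saturated (fun m => 1 < mdeg m)%N.
Proof.
split=> [m m' m2|m /edge_monomialP[i [j [_ [m' ->]]]]].
  by rewrite mdegD (leq_trans m2) ?leq_addr.
by rewrite !mdegD !mdeg1.
Qed.

(** [in_vars S] is the ideal generated by the variables in [S]. *)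
Definition in_vars S := in_monomial_ideal (var_monomial S).

(** The square of the maximal ideal [ker eps]. *)
Definition in_square := in_monomial_ideal (fun m => 1 < mdeg m)%N.

Lemma in_vars_var S t : t \in S -> in_vars S (var t).
Proof.
move=> tS; apply/(in_monomial_ideal_pi _ (var_monomial_saturated S).2).
apply: supported_inX; apply/orP; right; apply/exists_inP.
by exists t; rewrite // mnm1E eqxx.
Qed.

Lemma in_vars_setT u : eps u = 0 -> in_vars [set: 'I_N] u.
Proof.
move=> /eps0P u0 m /u0; rewrite mdegE lt0n sum_nat_eq0 negb_forall.
move=> /existsP[t mt]; apply/orP; right; apply/exists_inP.
by exists t; rewrite ?lt0n.
Qed.

Lemma in_square_mul u v : eps u = 0 -> eps v = 0 -> in_square (u * v).
Proof.
move=> /eps0P u0 /eps0P v0; rewrite -[u]reprK -[v]reprK -rmorphM.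
apply/(in_monomial_ideal_pi _ degree2_saturated.2).
move=> m /msuppM_le /allpairsP[[m1 m2] /= [/u0 m1_gt0 /v0 m2_gt0 ->]].
by rewrite mdegD -addn1 leq_add.
Qed.

(** If a monomial [m] is such that [m x_t] is divisible by an edge, then either
    the edge already divides [m], or it has [t] as an endpoint and its other
    endpoint, a neighbour of [t], divides [m]. *)
Lemma in_vars_colon S t u : t \notin S ->
  in_vars S (u * var t) -> in_vars (S :|: [set j | e t j]) u.
Proof.
move=> tS; rewrite -{1}[u]reprK -rmorphM.
move/(in_monomial_ideal_pi _ (var_monomial_saturated S).2) => Hu m mu.
have /orP[] : var_monomial S (m + U_(t))%MM.
- apply: Hu; rewrite (perm_mem (msuppMX _ _)); apply/mapP; exists m => //.
  by rewrite addmC.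
- have add_nbr j : e t j -> (0 < m j)%N -> var_monomial (S :|: [set j | e t j]) m.
    move=> etj mj; apply/orP; right; apply/exists_inP.
    by exists j; rewrite // !inE etj orbT.
  move=> /existsP[i /existsP[j /andP[eij /mnm_lepP le_m]]].
  have [ti|ti] := eqVneq t i.
    apply: (add_nbr j); first by rewrite ti.
    by have := le_m j; rewrite !mnmDE !mnm1E ti eqxx; case: (i == j) => /=; lia.
  have [tj|tj] := eqVneq t j.
    apply: (add_nbr i); first by rewrite tj e_sym.
    by have := le_m i; rewrite !mnmDE !mnm1E tj eqxx; case: (j == i) => /=; lia.
  apply/orP; left; apply/existsP; exists i; apply/existsP; exists j.
  rewrite eij; apply/mnm_lepP => l; have := le_m l; rewrite !mnmDE !mnm1E.
  case: (eqVneq t l) => [<-|_]; last by rewrite addn0.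
  by rewrite ![_ == t]eq_sym (negPf ti) (negPf tj).
- move=> /exists_inP[s sS]; rewrite mnmDE mnm1E => ms.
  apply/orP; right; apply/exists_inP; exists s; first by rewrite inE sS.
  by move: ms; case: eqP tS => [->|_ _]; rewrite ?sS ?addn0.
Qed.

(** Each monomial of [u] is a multiple of a variable in [S] or vanishes in [R];
    if it has degree at least [2], then the cofactor has positive degree. *)
Lemma in_vars_decomp S u : in_vars S u ->
  exists c : 'I_N -> R, u = \sum_(t in S) c t * var t /\
    (in_square u -> forall t, eps (c t) = 0).
Proof.
move=> Su.
have /choice[C CP] m : exists C : 'I_N -> poly, var_monomial S m ->
    toR 'X_[m] = \sum_(t in S) toR (C t) * var t /\
    ((1 < mdeg m)%N -> forall t, (C t).@[fun=> 0] = 0).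
  have [em|em] := boolP (edge_monomial m).
    exists (fun=> 0) => _; split=> [|_ t]; last by rewrite rmorph0.
    rewrite big1 => [|t _]; last by rewrite rmorph0 mul0r.
    rewrite -[RHS](rmorph0 toR); apply/eqP.
    rewrite -Quotient.idealrBE subr0; apply/edge_idealP.
    exact: supported_inX.
  have [/exists_inP[t tS mt]|nS] := boolP [exists t in S, (0 < m t)%N]; last first.
    by exists (fun=> 0); rewrite /var_monomial (negPf em) (negPf nS).
  exists (fun s => (s == t)%:R * 'X_[m - U_(t)]) => _; split=> [|m2 s].
    rewrite (bigD1 t) //= eqxx mul1r big1 ?addr0 => [|s /andP[_ /negPf->]].
      by rewrite -rmorphM -mpolyXD submK // lep1mP -lt0n.
    by rewrite mul0r rmorph0 mul0r.
  have [_|_] := eqVneq s t; last by rewrite mul0r rmorph0.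
  rewrite mul1r meval0 mcoeffX -mdeg_eq0.
  have /(congr1 (@mdeg N)) : (m - U_(t) + U_(t) = m)%MM.
    by rewrite submK // lep1mP -lt0n.
  by rewrite mdegD mdeg1; case: eqP => // -> m1; rewrite -m1 in m2.
pose p := repr u.
exists (fun t => toR (\sum_(m <- msupp p) (p@_m)%:MP * C m t)); split.
  rewrite -{1}[u]reprK {1}[repr u]mpolyE rmorph_sum /= big_seq.
  transitivity (\sum_(m <- msupp p | m \in msupp p)
      \sum_(t in S) toR (p@_m)%:MP * (toR (C m t) * var t)).
    apply: eq_bigr => m mp; rewrite -mulr_sumr -(CP m (Su m mp)).1.
    by rewrite -mul_mpolyC rmorphM.
  rewrite -big_seq exchange_big; apply: eq_bigr => t _ /=.
  rewrite rmorph_sum mulr_suml; apply: eq_bigr => m _.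
  by rewrite rmorphM mulrA.
move=> u2 t; rewrite graph_aug_pi rmorph_sum big_seq big1 // => m mp /=.
by rewrite rmorphM /= (CP m (Su m mp)).2 ?mulr0 // u2.
Qed.

End GraphAlgebraIdeals.

(** * The linear resolution *)

Section LinearResolution.
Variables (k : fieldType) (N : nat) (e : rel 'I_N).
Hypothesis e_sym : ssrbool.symmetric e.
Local Notation R := (graph_algebra k e).
Local Notation eps := (@graph_aug k N e).
Implicit Types (S : {set 'I_N}) (i j t : 'I_N).
Local Notation var := (@var k N e).
Local Notation in_vars := (@in_vars k N e).
Local Notation in_square := (@in_square k N e).
Local Notation toR := (\pi_({ideal_quot (edge_ideal e)})%qT : {mpoly k[N]} -> R).

(** The variables that generate the colon ideal by [x_t] of the ideal of the
    variables of [S] smaller than [t]. *)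
Definition colon_vars S t := [set s in S | (s < t)%N] :|: [set j | e t j].

(** One stage of the resolution: a free module, the submodule [lv_syz] that the
    next differential has to hit, and for each basis element [w] the set
    [lv_vars w] of variables that generate the ideal of leading coefficients of
    [lv_syz] at [w]. Basis elements are compared by [lv_key], and the leading
    coefficient of a vector is its last nonzero one. *)
Record level := Level {
  lv_rank : nat;
  lv_vars : 'I_lv_rank -> {set 'I_N};
  lv_key : 'I_lv_rank -> nat;
  lv_syz : 'rV[R]_lv_rank -> Prop }.

Definition below L b (u : 'rV[R]_(lv_rank L)) :=
  forall w, (b <= lv_key w)%N -> u 0 w = 0.

Definition syz_with_lead L (w : 'I_(lv_rank L)) t (s : 'rV[R]_(lv_rank L)) :=
  [/\ lv_syz s, below (lv_key w).+1 s, s 0 w = var t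
    & forall w', eps (s 0 w') = 0].

(** [lv_lead] and [lv_gen] say that the leading coefficients at [w] are exactly
    the ideal of [lv_vars w], each generating variable being reached by an element
    of [lv_syz] without unit coefficients. *)
Record good_level L : Prop := GoodLevel {
  lv_key_inj : injective (@lv_key L);
  lv_syz0 : @lv_syz L 0;
  lv_syzD : forall u v : 'rV_(lv_rank L), lv_syz u -> lv_syz v -> lv_syz (u + v);
  lv_syzZ : forall a (u : 'rV_(lv_rank L)), lv_syz u -> lv_syz (a *: u);
  lv_lead : forall w (u : 'rV_(lv_rank L)), lv_syz u -> below (lv_key w).+1 u ->
    in_vars (lv_vars w) (u 0 w);
  lv_gen : forall w t, t \in @lv_vars L w -> exists s, syz_with_lead w t s }.

Definition next_index L : {set 'I_(lv_rank L) * 'I_N} :=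
  [set p | p.2 \in lv_vars p.1].

Definition parent L (a : 'I_#|next_index L|) := (enum_val a).1.
Definition label L (a : 'I_#|next_index L|) := (enum_val a).2.

Definition syz_mx L : 'M[R]_(#|next_index L|, lv_rank L) :=
  \matrix_a xget 0 [set s | syz_with_lead (parent a) (label a) s].

(** The key of [(w, t)] encodes the lexicographic order, as [t < N]. *)
Definition next_level L : level := @Level #|next_index L|
  (fun a => colon_vars (lv_vars (parent a)) (label a))
  (fun a => lv_key (parent a) * N + label a)%N
  (fun v => v *m syz_mx L = 0).

Section GoodLevel.
Variable L : level.
Hypothesis gL : good_level L.

Lemma big_next_index (T : Type) (idx : T) (op : Monoid.com_law idx)
    (f : 'I_(lv_rank L) -> 'I_N -> T) :
  \big[op/idx]_a f (parent a) (label a) =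
  \big[op/idx]_w \big[op/idx]_(t in lv_vars w) f w t.
Proof.
rewrite pair_big_dep -(big_enum_val (fun p => f p.1 p.2)) /=.
by apply: eq_bigl => p; rewrite inE.
Qed.

Lemma next_indexP (a : 'I_#|next_index L|) : label a \in lv_vars (parent a).
Proof. by have := enum_valP a; rewrite inE. Qed.

Lemma syz_mxP a : syz_with_lead (parent a) (label a) (row a (syz_mx L)).
Proof. by rewrite rowK; apply: xgetPex; apply: (lv_gen gL); apply: next_indexP. Qed.

Lemma lv_syz_sum (I : Type) (r : seq I) (Q : pred I) (F : I -> 'rV[R]_(lv_rank L)) :
  (forall x, Q x -> lv_syz (F x)) -> lv_syz (\sum_(x <- r | Q x) F x).
Proof.
move=> HF; apply: big_ind => //; first exact: lv_syz0.
exact: (lv_syzD gL).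
Qed.

Lemma mul_syz_mx_syz (v : 'rV_#|next_index L|) : lv_syz (v *m syz_mx L).
Proof.
rewrite mulmx_sum_row; apply: lv_syz_sum => a _.
by apply: (lv_syzZ gL); case: (syz_mxP a).
Qed.

(** The chosen rows generate [lv_syz] by division with respect to leading
    coefficients: the leading coefficient of [u] is a combination of variables,
    and subtracting the matching combination of rows lowers [u]. The coefficients
    used lie in the maximal ideal when those of [u] lie in its square; this keeps
    the resolution minimal. *)
Lemma lv_syz_gen b (u : 'rV_(lv_rank L)) : lv_syz u -> below b u ->
  exists v, [/\ u = v *m syz_mx L,
    forall a, (b <= lv_key (parent a))%N -> v 0 a = 0
    & (forall w, in_square (u 0 w)) -> forall a, eps (v 0 a) = 0].
Proof.
elim: b u => [|b IHb] u syz_u ub.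
  exists 0; split=> [|a _|_ a]; rewrite ?mxE ?rmorph0 //.
  by rewrite mul0mx; apply/rowP => w; rewrite ub // mxE.
have [/existsP[w /eqP wb]|nw] := boolP [exists w, @lv_key L w == b]; last first.
  have [|v [eq_u vb v1]] := IHb u syz_u.
    move=> w; rewrite leq_eqVlt => /orP[/eqP wb|]; last exact: ub.
    by case/existsP: nw; exists w; rewrite wb.
  by exists v; split=> // a /ltnW; apply: vb.
have [|c [eq_c c1]] := in_vars_decomp (lv_lead gL (w := w) syz_u _).
  by rewrite wb.
(* The combination of rows over [w] that cancels the coefficient of [u] at [w]. *)
pose d := \row_a (if parent a == w then c (label a) else 0) : 'rV_#|next_index L|.
have dP w' : (b <= lv_key w')%N ->
    (d *m syz_mx L) 0 w' = if w' == w then u 0 w else 0.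
  move=> bw'; rewrite mxE; have [->|w'w] := eqVneq w' w; last first.
    rewrite big1 // => a _; rewrite [d 0 a]mxE; case: eqP => [aw|_].
      have [_ /(_ w') s_below _ _] := syz_mxP a; move: s_below.
      rewrite mxE => ->; first by rewrite mulr0.
      rewrite aw wb ltn_neqAle bw' andbT -wb eq_sym.
      by apply: contra_neq w'w => /(lv_key_inj gL).
    by rewrite mul0r.
  rewrite eq_c; pose f w' t := if w' == w then c t * var t else 0.
  transitivity (\sum_a f (parent a) (label a)).
    apply: eq_bigr => a _; rewrite [d 0 a]mxE /f; case: eqP => [aw|_].
      by have [_ _ + _] := syz_mxP a; rewrite mxE aw => ->.
    by rewrite mul0r.
  rewrite big_next_index /f (bigD1 w) //= eqxx [X in _ + X]big1 ?addr0 //.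
  by move=> w2 /negPf->; rewrite big1.
have [||v [eq_u vb v1]] := IHb (u - d *m syz_mx L).
- apply: (lv_syzD gL) => //; rewrite -scaleN1r; apply: (lv_syzZ gL).
  exact: mul_syz_mx_syz.
- move=> w' bw'; rewrite mxE [in X in _ + X]mxE dP //.
  have [->|w'w] := eqVneq w' w; first by rewrite subrr.
  rewrite subr0; apply: ub; rewrite ltn_neqAle bw' andbT -wb.
  by apply: contra_neq w'w => /(lv_key_inj gL).
exists (v + d); split=> [|a ba|u2 a].
- by rewrite mulmxDl -eq_u subrK.
- rewrite !mxE vb ?(ltnW ba) // add0r; case: eqP => // aw.
  by rewrite aw wb ltnn in ba.
rewrite mxE [d 0 a]mxE rmorphD /= v1 ?add0r; last first.
  have sat2 := degree2_saturated e.
  move=> w'; rewrite mxE; apply: in_monomial_idealD => //; first exact: u2.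
  rewrite mxE -mulN1r; apply: in_monomial_idealM => //.
  rewrite mxE; apply: in_monomial_ideal_sum => //.
  move=> a' _; apply: in_square_mul.
    by rewrite mxE; case: ifP => _; rewrite ?c1 ?rmorph0.
  by have [_ _ _ /(_ w')] := syz_mxP a'; rewrite mxE.
by case: ifP => _; rewrite ?c1 ?rmorph0.
Qed.

Lemma next_key_lt (a b : 'I_#|next_index L|) :
  (lv_key (parent a) < lv_key (parent b))%N ->
  (@lv_key (next_level L) a < @lv_key (next_level L) b)%N.
Proof.
move=> /= ab; have := ltn_ord (label a); have := leq_mul ab (leqnn N).
by rewrite mulSn; lia.
Qed.

Lemma next_key_eq (a b : 'I_#|next_index L|) :
  lv_key (parent a) = lv_key (parent b) ->
  (@lv_key (next_level L) a < @lv_key (next_level L) b)%N = (label a < label b)%N.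
Proof. by move=> /= ->; rewrite ltn_add2l. Qed.

Lemma next_index_inj (a b : 'I_#|next_index L|) :
  parent a = parent b -> label a = label b -> a = b.
Proof. rewrite /parent /label => ab1 ab2; apply: enum_val_inj.
by rewrite [LHS]surjective_pairing [RHS]surjective_pairing ab1 ab2. Qed.

Lemma next_index_surj w t : t \in lv_vars w ->
  exists a : 'I_#|next_index L|, parent a = w /\ label a = t.
Proof.
move=> tw; have wt : (w, t) \in next_index L by rewrite inE.
by exists (enum_rank_in wt (w, t)); rewrite /parent /label enum_rankK_in.
Qed.

Lemma next_key_inj : injective (@lv_key (next_level L)).
Proof.
move=> a b eq_ab; have := ltnn (@lv_key (next_level L) a).
have [lt_ab|lt_ba|eq1] := ltngtP (lv_key (parent a)) (lv_key (parent b)).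
- by rewrite {2}eq_ab next_key_lt.
- by rewrite {1}eq_ab next_key_lt.
move=> _; apply: next_index_inj; first exact: (lv_key_inj gL).
by move: eq_ab => /= /eqP; rewrite eq1 eqn_add2l => /eqP /val_inj.
Qed.

(** Look at the coordinate [parent a] of the relation [v *m syz_mx L = 0]. Rows
    over larger basis elements do not occur in [v], rows over smaller ones vanish
    there, and the row of [b] over the same basis element contributes
    [v 0 b * var (label b)]. Hence [v 0 a * var (label a)] is in the ideal of the
    smaller variables, and [in_vars_colon] applies. *)
Lemma next_lead (a : 'I_#|next_index L|) (v : 'rV_#|next_index L|) :
  v *m syz_mx L = 0 -> @below (next_level L) (@lv_key (next_level L) a).+1 v ->
  in_vars (colon_vars (lv_vars (parent a)) (label a)) (v 0 a).
Proof.
move=> v0 va; have satS := var_monomial_saturated e.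
apply: in_vars_colon => //; first by rewrite inE ltnn andbF.
have /rowP/(_ (parent a)) := v0; rewrite !mxE (bigD1 a) //=.
have [_ _ + _] := syz_mxP a; rewrite mxE => -> /eqP; rewrite addr_eq0 => /eqP->.
rewrite -mulN1r; apply: in_monomial_idealM => //.
apply: in_monomial_ideal_sum => // b ba.
have [_ s_below s_lead _] := syz_mxP b.
have [lt_ab|lt_ba|eq1] := ltngtP (lv_key (parent a)) (lv_key (parent b)).
- by rewrite va ?next_key_lt // mul0r; exact: in_monomial_ideal0.
- have := s_below _ lt_ba; rewrite mxE => ->.
  by rewrite mulr0; exact: in_monomial_ideal0.
have par_ab := lv_key_inj gL eq1; move: s_lead; rewrite mxE -par_ab => ->.
have [lt_ab|lt_ba|eq2] := ltngtP (label a) (label b).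
- by rewrite va ?next_key_eq // mul0r; exact: in_monomial_ideal0.
- apply: in_monomial_idealM => //; apply: in_vars_var.
  by rewrite inE lt_ba par_ab next_indexP.
by case/eqP: ba; apply: next_index_inj => //; apply: val_inj.
Qed.

(** If [t] is a smaller variable of the same set, the Koszul relation between the
    rows labelled [t] and [label a] cancels at [parent a]; if [t] is a neighbour
    of [label a], then [x_t] times the row of [a] vanishes there by itself. What
    is left lies strictly below [parent a] and has coefficients in the square of
    the maximal ideal, so [lv_syz_gen] removes it by a vector [v] with
    coefficients in the maximal ideal that leaves the leading coefficient
    alone. *)
Lemma next_gen (a : 'I_#|next_index L|) t :
  t \in colon_vars (lv_vars (parent a)) (label a) ->
  exists s, @syz_with_lead (next_level L) a t s.
Proof.
move=> t_colon; have [sa_syz sa_below sa_lead sa_eps] := syz_mxP a.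
have scale_row u (b : 'I_#|next_index L|) : eps u = 0 -> parent b = parent a ->
    let x : 'rV[R]_#|next_index L| := u *: delta_mx 0 b in
    [/\ forall c, eps (x 0 c) = 0,
      below (lv_key (parent a)).+1 (x *m syz_mx L),
      (x *m syz_mx L) 0 (parent a) = u * var (label b)
      & forall w, in_square ((x *m syz_mx L) 0 w)].
  move=> u0 ba x; have [_ s_below s_lead s_eps] := syz_mxP b.
  have xD : x *m syz_mx L = u *: row b (syz_mx L) by rewrite -scalemxAl -rowE.
  split=> [c|w aw||w]; rewrite ?xD mxE.
  - by rewrite rmorphM /= u0 mul0r.
  - by rewrite s_below ?mulr0 // ba.
  - by rewrite -ba s_lead.
  exact: in_square_mul.
(* The second half of the Koszul relation, or [0] for a neighbour. *)
have [y [y_a y_below y_eps [yD_below yD_lead yD_sq]]] :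
    exists y : 'rV_#|next_index L|,
    [/\ y 0 a = 0, @below (next_level L) (@lv_key (next_level L) a).+1 y,
      forall b, eps (y 0 b) = 0
    & [/\ below (lv_key (parent a)).+1 (y *m syz_mx L),
        (y *m syz_mx L) 0 (parent a) = var t * var (label a)
      & forall w, in_square ((y *m syz_mx L) 0 w)]].
  move: t_colon; rewrite !inE => /orP[/andP[tA t_lt]|at_edge].
    have [b [ba bt]] := next_index_surj tA.
    have [y_eps yD_below yD_lead yD_sq] := scale_row _ b (eps_var k e (label a)) ba.
    exists (var (label a) *: delta_mx 0 b); split=> //.
    - rewrite !mxE eqxx /=; case: eqP => [ab|_]; last by rewrite mulr0.
      by rewrite -bt ab ltnn in t_lt.
    - move=> c ac; rewrite !mxE eqxx /=; case: eqP => [cb|_]; last by rewrite mulr0.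
      by move: ac; rewrite cb /= ba ltn_add2l bt ltnNge ltnW.
    by rewrite yD_lead bt mulrC.
  exists 0; rewrite mul0mx; split=> [|b _|b|]; rewrite ?mxE ?rmorph0 //.
  split=> [w _||w]; rewrite ?mxE //.
    by rewrite mulrC var_edge.
  exact/in_monomial_ideal0/degree2_saturated.
have [x_eps xD_below xD_lead xD_sq] := scale_row _ a (eps_var k e t) erefl.
pose z : 'rV_#|next_index L| := var t *: delta_mx 0 a - y.
have z_below : @below (next_level L) (@lv_key (next_level L) a).+1 z.
  move=> b ab; rewrite !mxE y_below // subr0 eqxx /=; case: eqP ab => [->|_ _].
    by rewrite ltnn.
  by rewrite mulr0.
have z_a : z 0 a = var t by rewrite !mxE !eqxx mulr1 y_a subr0.
have z_eps b : eps (z 0 b) = 0.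
  by rewrite mxE rmorphD /= x_eps mxE rmorphN /= y_eps subr0.
have zD_below : below (lv_key (parent a)) (z *m syz_mx L).
  move=> w; rewrite leq_eqVlt mulmxBl mxE [in X in _ + X]mxE => /orP[/eqP aw|aw].
    by rewrite -(lv_key_inj gL aw) xD_lead yD_lead subrr.
  by rewrite xD_below // yD_below // subrr.
have zD_sq w : in_square ((z *m syz_mx L) 0 w).
  have sat2 := degree2_saturated e.
  rewrite mulmxBl mxE; apply: in_monomial_idealD => //; first exact: xD_sq.
  by rewrite mxE -mulN1r; apply: in_monomial_idealM => //; apply: yD_sq.
have [v [eq_v v_below v_eps]] := lv_syz_gen (mul_syz_mx_syz z) zD_below.
exists (z - v); split.
- by rewrite /lv_syz /= mulmxBl -eq_v subrr.
- move=> b ab; rewrite mxE [in X in _ + X]mxE z_below // v_below ?subr0 // leqNgt.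
  by apply/negP => /next_key_lt; rewrite ltnNge ltnW.
- by rewrite mxE [in X in _ + X]mxE z_a v_below // subr0.
by move=> b; rewrite mxE [in X in _ + X]mxE rmorphB /= z_eps v_eps ?subrr.
Qed.

Lemma good_next_level : good_level (next_level L).
Proof.
split=> [||u v u0 v0|a u u0|a u u0 ua|a t ta] /=.
- exact: next_key_inj.
- by rewrite mul0mx.
- by rewrite mulmxDl u0 v0 addr0.
- by rewrite -scalemxAl u0 scaler0.
- exact: next_lead u0 ua.
- exact: next_gen ta.
Qed.

End GoodLevel.

(** The augmentation [R -> k], whose kernel is generated by all variables. *)
Definition level0 : level := @Level 1 (fun=> [set: 'I_N]) (fun=> 0%N)
  (fun u => map_mx eps u *m (1%:M : 'M_1) = 0).

Lemma good_level0 : good_level level0.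
Proof.
split=> /= [i j _||u v u0 v0|a u u0|w u u0 _|w t _].
- by rewrite !ord1.
- by rewrite map_mx0 mul0mx.
- by rewrite map_mxD mulmxDl u0 v0 addr0.
- by rewrite map_mxZ -scalemxAl u0 scaler0.
- apply: in_vars_setT; move: u0; rewrite mulmx1 => /rowP/(_ w).
  by rewrite !mxE ord1.
exists (const_mx (var t)); split=> [|w' //||w'] /=.
- by apply/rowP => i; rewrite mulmx1 !mxE eps_var.
- by rewrite mxE.
- by rewrite mxE eps_var.
Qed.

Definition levels (i : nat) := iter i next_level level0.

Lemma good_levels (i : nat) : good_level (levels i).
Proof.
elim: i => [|i IHi] /=; first exact: good_level0.
exact: good_next_level.
Qed.

Lemma linear_aug_onto (c : 'M[k]_1) :
  exists u : 'rV[R]_(lv_rank (levels 0)), map_mx eps u *m (1%:M : 'M_1) = c.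
Proof.
exists (const_mx (toR (c 0 0)%:MP)); apply/matrixP => i j.
by rewrite mulmx1 !mxE graph_aug_pi mevalC !ord1.
Qed.

Lemma syz_mx_exact (i : nat) (u : 'rV_(lv_rank (levels i))) :
  lv_syz u <-> exists v, u = v *m syz_mx (levels i).
Proof.
have gi := good_levels i; split=> [u_syz|[v ->]]; last exact: mul_syz_mx_syz.
(* A bound above all keys: no condition on [u]. *)
pose b := (\max_w @lv_key (levels i) w).+1.
have [w|v [eq_u _ _]] := lv_syz_gen gi (b := b) u_syz; last by exists v.
by rewrite ltnNge leq_bigmax.
Qed.

Definition linear_resolution : free_resolution eps :=
  @FreeResolution k R eps (fun i : nat => lv_rank (levels i))
    (fun i : nat => syz_mx (levels i)) 1%:M
    linear_aug_onto (@syz_mx_exact 0) (fun i : nat => @syz_mx_exact i.+1).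

Lemma linear_resolution_minimal (i : nat) : tensor_d linear_resolution i = 0.
Proof.
apply/matrixP => a w; rewrite !mxE.
by have [_ _ _ /(_ w)] := syz_mxP (good_levels i) a; rewrite !mxE.
Qed.

(** The number of words [t_1 ... t_i] with [t_1] in [S] and each next letter in
    the set obtained by [colon_vars] from the previous set and letter. *)
Fixpoint betti (i : nat) S : nat :=
  if i is j.+1 then \sum_(t in S) betti j (colon_vars S t) else 1.

(** A word of length [i + j] splits into its first [i] letters, a basis element of
    level [i], and a word of length [j]. *)
Lemma sum_betti_levels (i j : nat) :
  (\sum_(a < lv_rank (levels i)) betti j (lv_vars a) = betti (i + j) [set: 'I_N])%N.
Proof.
elim: i j => [|i IHi] j; first by rewrite big_ord1.
rewrite addSnnS -IHi /=.
by rewrite (big_next_index _ (fun a t => betti j (colon_vars (lv_vars a) t))).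
Qed.

(** By minimality the differentials of [F (x)_R k] vanish, so its homology has the
    dimension of the terms. *)
Lemma tor_dim_betti (i : nat) : tor_dim eps i = betti i [set: 'I_N].
Proof.
rewrite (tor_dimE linear_resolution) -[i in RHS]addn0 -sum_betti_levels.
rewrite sum1_card card_ord.
by case: i => [|i]; rewrite /= !linear_resolution_minimal mxrank0 subn0 //
  kermx0 mxrank1.
Qed.

End LinearResolution.

(** * Betti series of cones *)

Lemma fps_addE (a b : fps int) i : (a + b) i = a i + b i.
Proof. by []. Qed.

Lemma fps_sumE (I : finType) (S : {pred I}) (F : I -> fps int) i :
  (\sum_(s in S) F s) i = \sum_(s in S) F s i.
Proof. by apply: (big_morph (fun a : fps int => a i)). Qed.

Lemma fps_mul_t0 (a : fps int) : (fps_t int * a) 0%N = 0.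
Proof. by rewrite /GRing.mul /= /fps_mul big_ord1 mul0r. Qed.

Lemma fps_mul_tS (a : fps int) i : (fps_t int * a) i.+1 = a i.
Proof.
rewrite /GRing.mul /= /fps_mul !big_ord_recl big1 ?addr0; last first.
  by move=> j _; rewrite mul0r.
by rewrite mul0r add0r /fps_t /= mul1r subn1.
Qed.

Section BettiSeries.
Variables (N : nat) (e : rel 'I_N).
Implicit Types S : {set 'I_N}.

Definition betti_series S : fps int := fun i => (betti e i S)%:Z.

Lemma betti_seriesE S : betti_series S =
  1 + fps_t int * \sum_(s in S) betti_series (colon_vars e S s).
Proof.
apply: funext => -[|i]; rewrite fps_addE ?fps_mul_t0 ?addr0 //.
rewrite fps_mul_tS fps_sumE [X in X + _](_ : _ = 0) // add0r.
by rewrite /betti_series /= (big_morph Posz PoszD (erefl 0)).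
Qed.

(** The factor [t] makes each coefficient of [D] depend on earlier ones only. *)
Lemma colon_recursion_eq0 (D : {set 'I_N} -> fps int) :
  (forall S, D S = fps_t int * \sum_(s in S) D (colon_vars e S s)) ->
  forall S, D S = 0.
Proof.
move=> DE S; apply: funext => i; elim: i S => [|i IHi] S; rewrite DE.
  by rewrite fps_mul_t0.
by rewrite fps_mul_tS fps_sumE big1.
Qed.

End BettiSeries.

Lemma graph_poincareE (k : fieldType) N (e : rel 'I_N) : ssrbool.symmetric e ->
  graph_poincare k e = betti_series e [set: 'I_N].
Proof.
move=> e_sym; apply: funext => i.
by rewrite /graph_poincare /poincare_series tor_dim_betti.
Qed.

Section Cone.
Variables (n : nat) (e : rel 'I_n).

(** The center is [ord0], as in [wheel_graph], which is convertible to the cone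
    over [cycle_graph]. *)
Definition cone_graph : rel 'I_n.+1 := fun i j =>
  match unlift ord0 i, unlift ord0 j with
  | Some i', Some j' => e i' j'
  | None, None => false
  | _, _ => true
  end.

Lemma cone_graph_sym : ssrbool.symmetric e -> ssrbool.symmetric cone_graph.
Proof.
move=> e_sym i j; rewrite /cone_graph.
by case: (unlift ord0 i) => [i'|]; case: (unlift ord0 j).
Qed.

Definition rim (S : {set 'I_n}) : {set 'I_n.+1} := lift ord0 @: S.
Definition coned (S : {set 'I_n}) : {set 'I_n.+1} := ord0 |: rim S.

Lemma ord0_rim S : ord0 \notin rim S.
Proof. by apply/imsetP => -[j _ /eqP]; rewrite (negPf (neq_lift _ _)). Qed.

Lemma lift_rim S (j : 'I_n) : (lift ord0 j \in rim S) = (j \in S).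
Proof. exact/mem_imset/lift_inj. Qed.

Lemma lift_coned S (j : 'I_n) : (lift ord0 j \in coned S) = (j \in S).
Proof. by rewrite !inE lift_rim eq_sym (negPf (neq_lift _ _)). Qed.

Lemma coned_setT : coned [set: 'I_n] = [set: 'I_n.+1].
Proof.
apply/setP => i; rewrite [RHS]inE; case: (unliftP ord0 i) => [j|] ->.
  by rewrite lift_coned inE.
by rewrite !inE eqxx.
Qed.

Lemma colon_coned_center S : colon_vars cone_graph (coned S) ord0 = rim [set: 'I_n].
Proof.
apply/setP => i; rewrite /colon_vars !inE /cone_graph unlift_none andbF /=.
case: (unliftP ord0 i) => [j|] ->; last by rewrite (negPf (ord0_rim _)).
by rewrite lift_rim inE.
Qed.

(** The center is a neighbour of every rim vertex, so it is in the new set whether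
    or not it was in [S']. *)
Lemma colon_cone_lift (S' : {set 'I_n.+1}) (S : {set 'I_n}) (j : 'I_n) :
  (forall i : 'I_n, (lift ord0 i \in S') = (i \in S)) ->
  colon_vars cone_graph S' (lift ord0 j) = coned (colon_vars e S j).
Proof.
move=> S'S; apply/setP => i; rewrite /colon_vars !inE /cone_graph liftK.
case: (unliftP ord0 i) => [l|] ->; last by rewrite eqxx orbT.
by rewrite S'S lift_rim !inE ltnS eq_sym (negPf (neq_lift _ _)).
Qed.

Lemma sum_rim S (F : 'I_n.+1 -> fps int) :
  \sum_(s in rim S) F s = \sum_(j in S) F (lift ord0 j).
Proof. by rewrite big_imset //= => i j _ _; apply: lift_inj. Qed.

Lemma betti_series_rim S : betti_series cone_graph (rim S) =
  1 + fps_t int * \sum_(j in S) betti_series cone_graph (coned (colon_vars e S j)).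
Proof.
rewrite betti_seriesE sum_rim; congr (_ + _ * _); apply: eq_bigr => j _.
by rewrite (@colon_cone_lift _ S) //; apply: lift_rim.
Qed.

Lemma betti_series_coned_rim S : betti_series cone_graph (coned S) =
  betti_series cone_graph (rim S) +
  fps_t int * betti_series cone_graph (rim [set: 'I_n]).
Proof.
rewrite betti_series_rim betti_seriesE big_setU1 ?ord0_rim //= sum_rim.
rewrite colon_coned_center mulrDr addrA addrAC; congr (_ + _ * _ + _).
by apply: eq_bigr => j _; rewrite (@colon_cone_lift _ S) //; apply: lift_coned.
Qed.

(** Both sides satisfy the same recursion in [S], with constant term [1 + t V],
    where [V] is the series of the whole rim. *)
Lemma betti_series_coned S : betti_series cone_graph (coned S) =
  (1 + fps_t int * betti_series cone_graph (rim [set: 'I_n])) * betti_series e S.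
Proof.
set V := betti_series _ (rim [set: 'I_n]); apply/eqP; rewrite -subr_eq0; apply/eqP.
pose D S :=
  betti_series cone_graph (coned S) - (1 + fps_t int * V) * betti_series e S.
apply: (@colon_recursion_eq0 _ e D) => {}S; rewrite /D sumrB -mulr_sumr.
rewrite betti_series_coned_rim betti_series_rim [betti_series e S]betti_seriesE.
by rewrite -/V; ring.
Qed.

End Cone.

Lemma cone_poincare (k : fieldType) n (e : rel 'I_n) : ssrbool.symmetric e ->
  let t := fps_t int in
  graph_poincare k (cone_graph e) * (1 + t - t * graph_poincare k e) =
  graph_poincare k e * (1 + t).
Proof.
move=> e_sym t; rewrite (graph_poincareE k e_sym).
rewrite (graph_poincareE k (cone_graph_sym e_sym)) -coned_setT.
set PC := betti_series e _; set PW := betti_series _ _.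
pose V := betti_series (cone_graph e) (rim [set: 'I_n]).
have PW1 : PW = (1 + t * V) * PC by apply: betti_series_coned.
have PW2 : PW = V + t * V by apply: betti_series_coned_rim.
rewrite mulrBr {2}PW2 {1}PW1.
ring.
Qed.

Theorem theorem5p3 (k : fieldType) (n : nat) (hn : (3 <= n)%N) :
  let t : fps int := fps_t int in
  let PC : fps int := graph_poincare k (@cycle_graph n) in
  let PW : fps int := graph_poincare k (@wheel_graph n) in
  PW = (PC * (1 + t)) / (1 + t - t * PC).
Proof.
move=> t PC PW; apply: canRL (mulrK _) _; last first.
  apply: cone_poincare => i j; exact: orbC.
change (fps_unit (1 + t - t * PC)); rewrite /fps_unit !fps_addE.
have -> : (- (t * PC)) 0%N = - (t * PC) 0%N by [].
by rewrite fps_mul_t0 oppr0 addr0.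
Qed.
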